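(* Let $(X,\mathcal{B})$ be a premeasurable space and let $\rho:\mathcal{B}\to[0,\infty]$ be a premeasure on $(X,\mathcal{B})$. Then there exists a measure $\mu$ on $(X,\sigma(\mathcal{B}))$ such that $\mu(B)=\rho(B)$ for all $B\in\mathcal{B}$, where $\sigma(\mathcal{B})$ denotes the $\sigma$-algebra on $X$ generated by $\mathcal{B}$.
   Context: A premeasurable space is a set $X$ together with an algebra $\mathcal{B}$ of subsets of $X$, i.e. a collection of subsets of $X$ closed under finite unions (including the empty union) and complements. A premeasure on $(X,\mathcal{B})$ is a map $\rho:\mathcal{B}\to[0,\infty]$ with $\rho(\emptyset)=0$ such that $\rho\left(\bigcup_{n=1}^\infty B_n\right)=\sum_{n=1}^\infty\rho(B_n)$ for every sequence $(B_n)_{n\ge 1}$ of pairwise disjoint elements of $\mathcal{B}$ whose union is also an element of $\mathcal{B}$. A measure on $(X,\sigma(\mathcal{B}))$ is a premeasure on $(X,\sigma(\mathcal{B}))$. *)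

(* Defs.v *)
From mathcomp Require Import all_boot all_order all_algebra.
From mathcomp Require Import all_classical all_reals all_analysis.

Set Implicit Arguments.
Unset Strict Implicit.
Unset Printing Implicit Defensive.

Local Open Scope classical_set_scope.
Local Open Scope ring_scope.
Local Open Scope ereal_scope.

(* algebraOfSetsType is not used for premeasurable spaces because its carrier
   is a pointed type, which would exclude the empty space.
   The empty union is covered by fin_bigcup_closed (with an empty index set). *)
Definition premeasurable_space (X : Type) (B : set (set X)) : Prop :=
  fin_bigcup_closed B /\ setC_closed B.

(* A map B -> [0, +oo] is encoded as a total function on set X, of which only
   the values on B are constrained. When B is a sigma-algebra, this is the
   notion of measure. *)
Definition premeasure (R : realType) (X : Type) (B : set (set X))
    (rho : set X -> \bar R) : Prop :=
  [/\ forall A, B A -> 0 <= rho A,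
      rho set0 = 0 &
      forall F : nat -> set X, (forall n, B (F n)) -> trivIset setT F ->
        B (\bigcup_n F n) ->
        rho (\bigcup_n F n) = \sum_(0 <= n <oo) rho (F n)].

(* Main.v *)
From HB Require Import structures.
Require Import Defs.
From mathcomp Require Import all_boot all_order all_algebra.
From mathcomp Require Import all_classical all_reals all_analysis.

(* On a pointed space this is the Carathéodory extension of the library. The
   total function rho is replaced by its absolute value, which agrees with it on
   B and is nonnegative everywhere, as the library requires of a measure.
   Library measures live on pointed types; on an empty space, B already contains
   every subset. *)

Local Open Scope classical_set_scope.
Local Open Scope ring_scope.
Local Open Scope ereal_scope.

(** A copy of [T] indexed by [B] and [hB], so that the algebra of sets can be inferred from the type
    alone. *)
Definition algebra_type (T : Type) (B : set (set T))
  (hB : premeasurable_space B) : Type := T.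

Section algebra_type.
Context (T : pointedType) (B : set (set T)) (hB : premeasurable_space B).
Local Notation aT := (algebra_type T B hB).

HB.instance Definition _ := Pointed.on aT.

Let B0 : B set0.
Proof. by have [] := (fin_bigcup_closedP B).2 hB.1. Qed.

Let BU : setU_closed B.
Proof. by have [] := (fin_bigcup_closedP B).2 hB.1. Qed.

Let BC : setC_closed B.
Proof. exact: hB.2. Qed.

HB.instance Definition _ :=
  @isAlgebraOfSets.Build default_measure_display aT B B0 BU BC.

Context (R : realType) (rho : set T -> \bar R) (hrho : premeasure B rho).

(** The proof argument is a tag from which the measure instance on this function is inferred. *)
Definition abse_premeasure (_ : premeasure B rho) (A : set aT) : \bar R :=
  `|rho A|.
Local Notation mu := (abse_premeasure hrho).

Let muE (A : set aT) : B A -> mu A = rho A.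
Proof.
by move=> BA; have [ge0 _ _] := hrho; rewrite /abse_premeasure gee0_abs// ge0.
Qed.

Let mu0 : mu set0 = 0.
Proof. by have [_ rho0 _] := hrho; rewrite muE. Qed.

Let mu_ge0 A : 0 <= mu A.
Proof. exact: abse_ge0. Qed.

Let mu_semi_sigma_additive : semi_sigma_additive mu.
Proof.
move=> F mF tF mUF; have [_ _ /(_ F mF tF mUF) rhoUF] := hrho.
rewrite muE// rhoUF -(eq_eseriesr (fun n _ => muE _ (mF n))).
(* The sum is by definition the limit of the partial sums; they converge because the terms
   [mu (F n)] are nonnegative. *)
exact: is_cvg_nneseries.
Qed.

HB.instance Definition _ :=
  isMeasure.Build _ aT R mu mu0 mu_ge0 mu_semi_sigma_additive.

Lemma premeasure_extension_pointed : exists nu : set T -> \bar R,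
  premeasure <<s B>> nu /\ (forall A, B A -> nu A = rho A).
Proof.
exists (measure_extension mu); split; last first.
  by move=> A BA; rewrite /measure_extension measurable_mu_extE//= muE.
split=> [A _||F mF tF mUF]; [exact: measure_ge0|exact: measure0|].
(* Limits in [\bar R] are unique, so convergence of the partial sums gives the equality. *)
apply/esym/cvg_lim => //.
exact: (@measure_semi_sigma_additive _ _ _ (measure_extension mu)).
Qed.

End algebra_type.

Theorem theorem7p4 (R : realType) (X : Type) (B : set (set X))
    (rho : set X -> \bar R) (hB : premeasurable_space B)
    (hrho : premeasure B rho) :
  exists mu : set X -> \bar R,
    premeasure <<s B>> mu /\ (forall A : set X, B A -> mu A = rho A).
Proof.
have [[x _]|X0] := pselect (exists x : X, True).
  (* Equality and choice on [X] are classical; the witness [x] is the point. *)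
  pose T : pointedType :=
    HB.pack X (gen_eqMixin X) (gen_choiceMixin X) (isPointed.Build X x).
  exact: (premeasure_extension_pointed T B hB R rho hrho).
(* With [X] empty, generating a sigma-algebra adds nothing to [B], so [rho] extends itself. *)
exists rho; split=> //.
suff -> : <<s B>> = B by [].
have B0 : B set0 by have [] := (fin_bigcup_closedP B).2 hB.1.
have BT A : B A.
  suff -> : A = set0 by [].
  by rewrite predeqE => x; case: X0; exists x.
by apply/seteqP; split=> A _; [exact: BT|apply: sub_sigma_algebra; exact: BT].
Qed.
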